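(* Let $d\in\mathbb N$. For $z\in\mathbb R^d$ let $u^z(t,x)=(2\pi t)^{-d/2}\exp\big(-\frac{|x-z|^2}{2t}\big)$, $t>0$. Let $\eta$ be an $\mathbb R^d$-valued random variable with $\mathcal L(\eta)=\mathcal N(0,1_d)$, set $X^z_t:=z+\eta\sqrt t$, $t\ge0$, and let $\mathbb V^z:=\mathcal L(X^z)$ be its law on $C([0,\infty);\mathbb R^d)$. Then $\{\mathbb V^z\}_{z\in\mathbb R^d}$ is a nonlinear Markov core for $\{u^z\}_{z\in\mathbb R^d}$.
   Context: $\mathcal N(0,1_d)$ is the standard normal distribution on $\mathbb R^d$. Notation: $\mathbb R_+=[0,\infty)$; $\mathcal P(T)$ is the set of Borel probability measures on $T$, $\mathcal P=\mathcal P(\mathbb R^d)$. $\mathcal C=C(\mathbb R_+;\mathbb R^d)$ with locally uniform convergence and Borel $\sigma$-algebra, $\pi_t(w)=w(t)$, $\mathcal F_t=\sigma(\pi_s:s\le t)$, $\Pi_t(w)=w(t+\cdot)$, $P_t:=P\circ\pi_t^{-1}$ for $P\in\mathcal P(\mathcal C)$. Nonlinear Markov process: a family $\{P^\zeta\}_{\zeta\in\mathcal P_0}\subset\mathcal P(\mathcal C)$, $\mathcal P_0\subseteq\mathcal P$, such that with $\mu^\zeta_t:=P^\zeta_t$: (i) $\mu^\zeta_0=\zeta$; (ii) $\mu^\zeta_t\in\mathcal P_0$ for all $t>0$; (iii) for all $s,t\ge0$, $\zeta\in\mathcal P_0$, $A\in\mathcal B(\mathbb R^d)$: $P^\zeta(\pi_{t+s}\in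 A\mid\mathcal F_s)(\cdot)=P^{\mu^\zeta_s,\pi_s(\cdot)}(\pi_t\in A)$ $P^\zeta$-a.s., where $\{P^{\xi,y}\}_y$ is, for $\xi\in\mathcal P_0$, the disintegration of $P^\xi$ with respect to $\pi_0$ (measurable in $y$, $P^\xi=\int P^{\xi,y}d\xi(y)$, $P^{\xi,y}(\pi_0=y)=1$ for $\xi$-a.e. $y$). Nonlinear Markov core: for $\{\mu^z_t\}_{t\ge0,z\in\mathbb R^d}\subset\mathcal P$ with $\mu^z_0=\delta_z$ and $(t,z)\mapsto\mu^z_t$ injective, $\{P^z\}_{z}\subset\mathcal P(\mathcal C)$ is a nonlinear Markov core for $\{\mu^z_t\}$ if $P^z_t=\mu^z_t$ for all $t\ge0$, $z\in\mathbb R^d$, and $\{P^\zeta\}_{\zeta\in\mathcal P_0}$, with $\mathcal P_0:=\{\mu^z_t:t\ge0,z\in\mathbb R^d\}$ and $P^\zeta:=P^z\circ\Pi_t^{-1}$ for $\zeta=\mu^z_t$, is a nonlinear Markov process. ''Core for $\{u^z\}$'' means with $\mu^z_t=u^z(t,x)dx$, $t>0$, $\mu^z_0=\delta_z$. *)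

(* Defs.v *)
From HB Require Import structures.
From mathcomp Require Import all_boot all_order all_algebra.
From mathcomp Require Import all_classical all_reals all_analysis.
From mathcomp Require Import measurable_realfun giry.

Set Implicit Arguments.
Unset Strict Implicit.
Unset Printing Implicit Defensive.

Import Order.TTheory GRing.Theory Num.Theory.
Import numFieldNormedType.Exports.
Local Open Scope classical_set_scope.
Local Open Scope ring_scope.

Section borel_matrix.
Context {R : realType} {m n : nat}.

HB.instance Definition _ :=
  @isMeasurable.Build (sigma_display (@open 'M[R]_(m, n))) 'M[R]_(m, n)
    <<s @open 'M[R]_(m, n) >>
    (@sigma_algebra0 _ setT _) (@sigma_algebraC _ _)
    (@sigma_algebra_bigcup _ setT _).

Lemma open_measurable_mx (U : set 'M[R]_(m, n)) : open U -> measurable U.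
Proof. by move=> oU; exact: sub_sigma_algebra. Qed.

Lemma measurable_coord i j :
  measurable_fun setT (fun M : 'M[R]_(m, n) => M i j).
Proof.
apply: (measurability _ (RGenOpens.measurableE R)).
move=> _ [_ [x [y ->]] <-]; rewrite setTI; apply: open_measurable_mx.
by apply: open_comp => [M _|]; [exact: coord_continuous|exact: interval_open].
Qed.

Lemma measurable_fun_mxP d (T : measurableType d) (f : T -> 'M[R]_(m, n)) :
  (forall i j, measurable_fun setT (fun x => f x i j)) ->
  measurable_fun setT f.
Proof.
move=> mf; apply: (measurability (@open 'M[R]_(m, n))) => //.
move=> _ [U oU <-]; rewrite setTI.
pose B (qk : 'M[rat]_(m, n) * nat) : set 'M[R]_(m, n) :=
  [set M | forall i j, ball (ratr (qk.1 i j) : R) qk.2.+1%:R^-1 (M i j)].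
pose I := [set qk | B qk `<=` U].
have -> : f @^-1` U =
    \bigcup_(qk : 'M[rat]_(m, n) * nat) if qk \in I then f @^-1` B qk else set0.
  apply/seteqP; split => [x Ux|x [qk _]]; last first.
    by case: ifPn => //; rewrite inE => /(_ (f x)) + /= Bx; exact.
  have /nbhs_ballP[e /= e0 eU] : nbhs (f x) U by exact: open_nbhs_nbhs.
  have [k ke] : exists k : nat, 2 * k.+1%:R^-1 < e.
    have := @near_infty_natSinv_lt R (PosNum (divr_gt0 e0 (@ltr0n R 2))).
    move=> [N _ /(_ N (leqnn N))] /= Ne; exists N.
    by rewrite mulrC -ltr_pdivlMr.
  have k0 : 0 < k.+1%:R^-1 :> R by [].
  have q_ (i : 'I_m) (j : 'I_n) :
      {q : rat | ball (ratr q : R) k.+1%:R^-1 (f x i j)}.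
    apply: cid.
    have /rat_in_itvoo[q] : f x i j - k.+1%:R^-1 < f x i j + k.+1%:R^-1.
      by rewrite ltrD2l (lt_trans _ k0)// oppr_lt0.
    rewrite in_itv/= => /andP[q1 q2]; exists q; rewrite /ball/= ltr_distlC.
    by apply/andP; split; [rewrite ltrBlDr|rewrite -ltrBlDr].
  exists (\matrix_(i, j) sval (q_ i j), k) => //.
  have BM M : B (\matrix_(i, j) sval (q_ i j), k) M ->
      forall i j, ball (f x i j) e (M i j).
    move=> BM i j; apply: le_ball (ltW ke) _ _.
    rewrite mulrDl mul1r; apply: ball_triangle; last exact: (BM i j).
    by apply: ball_sym; rewrite /= mxE; exact: (svalP (q_ i j)).
  rewrite ifT; last by rewrite inE => M /BM fM; apply: eU; split.
  by move=> i j /=; rewrite mxE; exact: (svalP (q_ i j)).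
apply: countable_bigcupT_measurable => // -[q k]; case: ifPn => // _.
rewrite (_ : f @^-1` B (q, k) =
    \bigcap_(ij in [set: 'I_m * 'I_n])
      (fun x => f x ij.1 ij.2) @^-1` ball (ratr (q ij.1 ij.2) : R) k.+1%:R^-1).
  apply: fin_bigcap_measurable => // -[i j] _ /=.
  by rewrite -[X in measurable X]setTI; apply: mf => //; exact: measurable_ball.
by apply/seteqP; split => x /= Bx; [move=> [i j] _; exact: Bx|
  move=> i j; exact: (Bx (i, j))].
Qed.

End borel_matrix.

Section lebesgue_rV.
Context {R : realType}.

Definition cons_rV n (p : R * 'rV[R]_n) : 'rV[R]_n.+1 :=
  row_mx (const_mx p.1 : 'rV_1) p.2.

Definition uncons_rV n (v : 'rV[R]_n.+1) : R * 'rV[R]_n :=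
  (v ord0 ord0, rsubmx (v : 'rV_(1 + n))).

Lemma cons_rVK n : cancel (@cons_rV n) (@uncons_rV n).
Proof.
case=> x v; rewrite /uncons_rV /cons_rV row_mxKr; congr pair.
by rewrite mxE; case: splitP => // j _; rewrite mxE.
Qed.

Lemma measurable_cons_rV n : measurable_fun setT (@cons_rV n).
Proof.
apply: measurable_fun_mxP => i j; rewrite ord1.
pose g (p : R * 'rV[R]_n) := match fintype.split (j : 'I_(1 + n)) with
  | inl _ => p.1 | inr k => p.2 ord0 k end : R.
rewrite [X in measurable_fun _ X](_ : _ = g).
  rewrite /g; case: (fintype.split _) => k; first exact: measurable_fst.
  by apply: measurableT_comp (measurable_coord ord0 k) _; exact: measurable_snd.
apply/funext => -[x v]; rewrite /g mxE.
by case: (fintype.split _) => k //=; rewrite mxE.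
Qed.

Lemma measurable_uncons_rV n : measurable_fun setT (@uncons_rV n).
Proof.
apply: measurable_fun_pair; first exact: measurable_coord.
apply: measurable_fun_mxP => i j.
rewrite [X in measurable_fun _ X](_ : _ =
    (fun v : 'rV[R]_n.+1 => v i (rshift 1 j))).
  exact: measurable_coord.
by apply/funext => v; rewrite mxE.
Qed.

Section step.
Context (n : nat)
  (nu : {sigma_finite_measure set (measurableTypeR R) -> \bar R})
  (mu : {sigma_finite_measure set 'rV[R]_n -> \bar R}).
Local Open Scope ereal_scope.

Definition prod_cons : set 'rV[R]_n.+1 -> \bar R :=
  pushforward (nu \x mu) (@cons_rV n).

Let preimage_cons A : measurable A -> measurable (@cons_rV n @^-1` A).
Proof.
by move=> mA; rewrite -[X in measurable X]setTI; exact: measurable_cons_rV.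
Qed.

Let prod_cons0 : prod_cons set0 = 0.
Proof. by rewrite /prod_cons /pushforward preimage_set0 measure0. Qed.

Let prod_cons_ge0 A : 0 <= prod_cons A.
Proof. exact: (measure_ge0 (nu \x mu)). Qed.

Let prod_cons_sigma_additive : semi_sigma_additive prod_cons.
Proof.
move=> F mF tF mUF; rewrite /prod_cons /pushforward preimage_bigcup.
apply: measure_semi_sigma_additive.
- by move=> k; exact: preimage_cons.
- apply/trivIsetP => /= i j _ _ ij; rewrite -preimage_setI.
  by move/trivIsetP : tF => /(_ _ _ _ _ ij) ->//; rewrite preimage_set0.
- by rewrite -preimage_bigcup; exact: preimage_cons.
Qed.

HB.instance Definition _ := isMeasure.Build _ _ _ prod_cons
  prod_cons0 prod_cons_ge0 prod_cons_sigma_additive.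

Let prod_cons_sigma_finite : sigma_finite setT prod_cons.
Proof.
have /sigma_finiteP[F [FT ndF Foo]] := sigma_finiteT nu.
have /sigma_finiteP[G [GT ndG Goo]] := sigma_finiteT mu.
exists (fun k => @uncons_rV n @^-1` (F k `*` G k)).
  apply/esym; rewrite -subTset => v _.
  have [i _ Fi] : (\bigcup_i F i) (uncons_rV v).1 by rewrite -FT.
  have [j _ Gj] : (\bigcup_i G i) (uncons_rV v).2 by rewrite -GT.
  exists (maxn i j) => //; split.
    by move: Fi; exact/subsetPset/ndF/leq_maxl.
  by move: Gj; exact/subsetPset/ndG/leq_maxr.
move=> k; have [mF Fk] := Foo k; have [mG Gk] := Goo k; split.
  rewrite -[X in measurable X]setTI; apply: measurable_uncons_rV => //.
  exact: measurableX.
rewrite /prod_cons /pushforward -comp_preimage.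
rewrite (_ : _ \o _ = id); last by apply/funext => p; exact: cons_rVK.
by rewrite preimage_id product_measure1E// lte_mul_pinfty// ge0_fin_numE.
Qed.

HB.instance Definition _ := Measure_isSigmaFinite.Build _ _ _
  prod_cons prod_cons_sigma_finite.

End step.

(* The n-fold product of the one-dimensional Lebesgue measure. *)
Fixpoint lebesgue_rV n : {sigma_finite_measure set 'rV[R]_n -> \bar R} :=
  if n is m.+1 then prod_cons lebesgue_measure (lebesgue_rV m)
  else \d_(0 : 'rV[R]_0).

End lebesgue_rV.

Lemma lebesgue_rV_box (R : realType) n (a b : 'I_n -> R) :
  (forall i, a i <= b i) ->
  lebesgue_rV n [set v : 'rV[R]_n | forall i, v ord0 i \in `]a i, b i]] =
  (\prod_i (b i - a i))%:E.
Proof.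
elim: n a b => [|n IH] a b ab.
  by rewrite big_ord0 /= diracE mem_set //= => -[].
rewrite big_ord_recl /= /prod_cons /pushforward.
pose B := [set v : 'rV[R]_n |
  forall i, v ord0 i \in `]a (lift ord0 i), b (lift ord0 i)]].
rewrite (_ : _ @^-1` _ = `]a ord0, b ord0]%classic `*` B).
  rewrite product_measure1E//.
    have L : lebesgue_measure `]a ord0, b ord0]%classic =
        (b ord0 - a ord0)%:E.
      rewrite lebesgue_measure_itv/= lte_fin.
      have := ab ord0; rewrite le_eqVlt => /predU1P[->|->//].
      by rewrite ltxx subrr.
    by rewrite EFinM -L -IH.
  rewrite (_ : B = \bigcap_(i in [set: 'I_n])
      (fun v : 'rV[R]_n => v ord0 i) @^-1`
      `]a (lift ord0 i), b (lift ord0 i)]).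
    apply: fin_bigcap_measurable => // i _; rewrite -[X in measurable X]setTI.
    exact: measurable_coord.
  by apply/seteqP; split => v /= h i; [move=> _; exact: h|exact: (h i I)].
apply/seteqP; split => -[x v] /=.
  move=> h; split.
    by have := h ord0; rewrite /cons_rV mxE; case: splitP => // j _; rewrite mxE.
  move=> i; have := h (lift ord0 i); rewrite /cons_rV mxE.
  case: splitP => [j|k] /=.
    by rewrite /bump leq0n add1n; case: j => -[].
  by rewrite /bump leq0n !add1n => -[] /val_inj ->.
move=> [hx hv] i; rewrite /cons_rV mxE; case: splitP => j.
  by rewrite mxE (ord1 j) => /= i0; rewrite (_ : i = ord0)//; exact: val_inj.
by move=> e; rewrite (_ : i = lift ord0 j) //; exact: val_inj.
Qed.

Section time.
Context {R : realType}.

Definition Rplus : set R := [set t | 0 <= t].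

Definition mk_time (t : R) (t0 : 0 <= t) : Rplus :=
  SigSub (mem_set t0 : t \in Rplus).

Lemma time_ge0 (t : Rplus) : 0 <= val t.
Proof. by have := valP t; rewrite inE. Qed.

Definition time0 : Rplus := mk_time (lexx 0).

Definition time_add (s t : Rplus) : Rplus :=
  mk_time (addr_ge0 (time_ge0 s) (time_ge0 t)).

Lemma continuous_time_val : continuous (fun t : Rplus => val t).
Proof. exact: (@initial_continuous Rplus R set_val). Qed.

Lemma continuous_time_add (s : Rplus) : continuous (time_add s).
Proof.
have h : continuous (fun t : Rplus => val s + val t : R).
  have sD : continuous (fun r : R => val s + r).
    by move=> r; apply: (@cvgD R R^o); [exact: cvg_cst|exact: cvg_id].
  by move=> t; exact: (continuous_comp (@continuous_time_val t) (sD _)).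
exact: (@continuous_comp_initial Rplus Rplus R set_val).
Qed.

End time.
Arguments Rplus : clear implicits.

Section pathspace.
Context {R : realType} {d : nat}.

Definition pathspace := continuousType (Rplus R) 'rV[R]_d.

(* On the locally compact space R_+, locally uniform convergence is uniform
   convergence on compact sets. *)
HB.instance Definition _ := Topological.copy pathspace
  (initial_topology
    (fun w : pathspace => (w : {family compact, Rplus R -> 'rV[R]_d}))).

HB.instance Definition _ :=
  isPointed.Build pathspace (cst 0 : continuousType (Rplus R) 'rV[R]_d).

HB.instance Definition _ :=
  @isMeasurable.Build (sigma_display (@open pathspace)) pathspace
    <<s @open pathspace >>
    (@sigma_algebra0 _ setT _) (@sigma_algebraC _ _)
    (@sigma_algebra_bigcup _ setT _).

Lemma open_measurable_path (U : set pathspace) : open U -> measurable U.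
Proof. by move=> oU; exact: sub_sigma_algebra. Qed.

Definition eval_at (t : Rplus R) (w : pathspace) : 'rV[R]_d := w t.

Lemma nbhs_path (w : pathspace) (A : set (Rplus R)) E : compact A ->
  entourage E ->
  nbhs w [set w' : pathspace | forall t, A t -> E (w t, w' t)].
Proof.
move=> cA entE.
have /(_ _ (fam_nbhs (w : {family compact, Rplus R -> 'rV[R]_d}) entE cA)) :=
  @initial_continuous pathspace {family compact, Rplus R -> 'rV[R]_d}
    (fun w => w) w.
exact.
Qed.

Lemma continuous_to_path (T : topologicalType) (f : T -> pathspace) :
  (forall x (A : set (Rplus R)) E, compact A -> entourage E ->
    \forall x' \near x, forall t, A t -> E (f x t, f x' t)) ->
  continuous f.
Proof.
move=> cf.
apply: (@continuous_comp_initial pathspace T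
  {family compact, Rplus R -> 'rV[R]_d} (fun w => w)) => x.
apply/fam_cvgP => A cA P /uniform_nbhs[E [entE EP]].
by have := cf x A E cA entE; apply: filterS => y Ey; exact: EP.
Qed.

Lemma continuous_eval_at t : continuous (eval_at t).
Proof.
move=> w U; rewrite -[nbhs (eval_at t w) U]/(nbhs (w t) U).
rewrite -nbhs_entourageE => -[E entE EU].
have := nbhs_path w (@compact_set1 _ t) entE.
by apply: filterS => w' Ew'; apply: EU; apply/xsectionP; exact: Ew'.
Qed.

Lemma measurable_eval_at t : measurable_fun setT (eval_at t).
Proof.
apply: (measurability (@open 'rV[R]_d)) => // _ [U oU <-]; rewrite setTI.
apply: open_measurable_path; apply: open_comp => // w _.
exact: continuous_eval_at.
Qed.

HB.instance Definition _ t :=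
  isMeasurableFun.Build _ _ _ _ (eval_at t) (measurable_eval_at t).

Lemma continuous_path_shift_fun (s : Rplus R) (w : pathspace) :
  continuous (fun t : Rplus R => w (time_add s t)).
Proof.
move=> t; apply: continuous_comp; first exact: continuous_time_add.
exact: cts_fun.
Qed.

Definition path_shift (s : Rplus R) (w : pathspace) : pathspace :=
  mkcts (continuous_path_shift_fun (s := s) (w := w)).

Lemma continuous_path_shift s : continuous (path_shift s).
Proof.
apply: continuous_to_path => w A E cA entE.
have csA : compact (time_add s @` A).
  apply: continuous_compact => //; apply: continuous_subspaceT.
  exact: continuous_time_add.
have := nbhs_path w csA entE.
by apply: filterS => w' Ew' t At /=; apply: Ew'; exists t.
Qed.

Lemma measurable_path_shift s : measurable_fun setT (path_shift s).
Proof.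
apply: (measurability (@open pathspace)) => // _ [U oU <-]; rewrite setTI.
apply: open_measurable_path; apply: open_comp => // w _.
exact: continuous_path_shift.
Qed.

HB.instance Definition _ s :=
  isMeasurableFun.Build _ _ _ _ (path_shift s) (measurable_path_shift s).

Lemma continuous_sqrt_path_fun (z x : 'rV[R]_d) :
  continuous (fun t : Rplus R => z + Num.sqrt (val t) *: x).
Proof.
have cg : continuous (fun r : R => z + Num.sqrt r *: x).
  move=> r; apply: cvgD; first exact: cvg_cst.
  by apply: cvgZr_tmp; exact: sqrt_continuous.
by move=> t; exact: (continuous_comp (@continuous_time_val R t) (cg _)).
Qed.

Definition sqrt_path (z x : 'rV[R]_d) : pathspace :=
  mkcts (continuous_sqrt_path_fun (z := z) (x := x)).

Lemma continuous_sqrt_path z : continuous (sqrt_path z).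
Proof.
apply: continuous_to_path => x A E cA; rewrite -entourage_ballE => -[e /= e0 eE].
have csA : compact ((fun t : Rplus R => Num.sqrt (val t)) @` A).
  apply: continuous_compact => //; apply: continuous_subspaceT => t.
  apply: (continuous_comp (@continuous_time_val R t)).
  exact: sqrt_continuous.
have [M [Mreal MA]] := compact_bounded csA.
pose N := `|M| + 1.
have N0 : 0 < N by rewrite ltr_wpDl.
have sN t : A t -> Num.sqrt (val t) <= N.
  move=> At; have := MA N; rewrite ltr_pwDr ?ler_norm//.
  move=> /(_ isT (Num.sqrt (val t))) /= h.
  by rewrite (le_trans (ler_norm _))// h//; exists t.
near=> x' => t At; apply: eE => /=; rewrite -ball_normE /= /ball_ /=.
rewrite opprD addrACA subrr add0r -scalerBr normrZ ger0_norm ?sqrtr_ge0//.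
rewrite (le_lt_trans (ler_wpM2r _ (sN _ At)))// mulrC -ltr_pdivlMr//.
near: x'; apply: cvgr_dist_lt; [exact: cvg_id|exact: divr_gt0].
Unshelve. all: by end_near. Qed.

Lemma measurable_sqrt_path z : measurable_fun setT (sqrt_path z).
Proof.
apply: (measurability (@open pathspace)) => // _ [U oU <-]; rewrite setTI.
apply: open_measurable_mx; apply: open_comp => // w _.
exact: continuous_sqrt_path.
Qed.

End pathspace.
Arguments pathspace : clear implicits.

Section sqrt_process.
Context {R : realType} {d : nat} {dO : measure_display}
  {Omega : measurableType dO}.

Definition sqrt_process (eta : {mfun Omega >-> 'rV[R]_d}) (z : 'rV[R]_d)
  (omega : Omega) : pathspace R d := sqrt_path z (eta omega).

Lemma measurable_sqrt_process eta z : measurable_fun setT (sqrt_process eta z).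
Proof.
by apply: (measurableT_comp (measurable_sqrt_path z)); exact: measurable_funPT.
Qed.

HB.instance Definition _ eta z :=
  isMeasurableFun.Build _ _ _ _ (sqrt_process eta z)
    (measurable_sqrt_process eta z).

End sqrt_process.

(* [f] is a version of the conditional probability of [E] given the
   sub-sigma-algebra [G]. *)
Definition is_cond_prob d (T : measurableType d) (R : realType)
    (P : probability T R) (G : set_system T) (E : set T) (f : T -> \bar R) :=
  [/\ forall B : set (\bar R), measurable B -> G (f @^-1` B),
      P.-integrable setT f &
      forall A, G A -> (\int[P]_(x in A) f x = P (E `&` A))%E].

Section nonlinear_markov.
Context {R : realType} {d : nat}.
Local Notation Rd := 'rV[R]_d.
Local Notation C := (pathspace R d).

Definition marginal (P : probability C R) (t : Rplus R) : probability Rd R :=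
  distribution P (eval_at t).

Definition shifted (P : probability C R) (t : Rplus R) : probability C R :=
  distribution P (path_shift t).

Definition path_filtration (t : Rplus R) : set_system C :=
  <<s \bigcup_(s in [set s : Rplus R | val s <= val t])
        preimage_set_system setT (eval_at s) (@measurable _ Rd) >>.

Definition is_disintegration (P : probability C R) (xi : probability Rd R)
    (K : R.-pker Rd ~> C) :=
  (forall B : set C, measurable B -> (P B = \int[xi]_y K y B)%E) /\
  {ae xi, forall y, K y [set w | w time0 = y] = 1%E}.

(* A [probability] also takes values on non-measurable sets, which carry no
   information: two of them are the same Borel measure when they are related by
   [≡μ].  The first clause says that [P0] and the family [P] restricted to [P0]
   depend only on the Borel measure.  The disintegration of [P xi] is unique up
   to [xi]-null sets: it is required to exist, and the Markov property is
   required of every version of it. *)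
Definition nonlinear_markov_process (P0 : set (probability Rd R))
    (P : probability Rd R -> probability C R) : Prop :=
  (forall zeta zeta' : probability Rd R, P0 zeta -> zeta ≡μ zeta' ->
     P0 zeta' /\ P zeta ≡μ P zeta') /\
  forall zeta, P0 zeta ->
    [/\ marginal (P zeta) time0 ≡μ zeta,
        forall t : Rplus R, 0 < val t -> P0 (marginal (P zeta) t),
        exists K, is_disintegration (P zeta) zeta K &
        forall (s t : Rplus R) (A : set Rd) (K : R.-pker Rd ~> C),
          measurable A ->
          is_disintegration (P (marginal (P zeta) s)) (marginal (P zeta) s) K ->
          exists2 f, is_cond_prob (P zeta) (path_filtration s)
                       (eval_at (time_add t s) @^-1` A) f &
            {ae P zeta, forall w, f w = K (eval_at s w) (eval_at t @^-1` A)}].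

(* [Q] is the family of the process, with [Q zeta] the law of the path shifted by
   [t] under [P z] when [zeta] is [mu t z]; the injectivity of [mu] makes it
   well defined. *)
Definition nonlinear_markov_core (mu : Rplus R -> Rd -> probability Rd R)
    (P : Rd -> probability C R) : Prop :=
  [/\ forall z, mu time0 z ≡μ \d_z,
      forall t z t' z', mu t z ≡μ mu t' z' -> (t, z) = (t', z'),
      forall t z, marginal (P z) t ≡μ mu t z &
      exists2 Q : probability Rd R -> probability C R,
        (forall t z (zeta : probability Rd R),
           zeta ≡μ mu t z -> Q zeta ≡μ shifted (P z) t) &
        nonlinear_markov_process
          [set zeta | exists t z, zeta ≡μ mu t z] Q].

Definition nonlinear_markov_core_density (u : Rd -> R -> Rd -> R)
    (P : Rd -> probability C R) : Prop :=
  exists2 mu : Rplus R -> Rd -> probability Rd R,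
    (forall z, mu time0 z ≡μ \d_z) /\
    (forall (t : Rplus R) z (A : set Rd), 0 < val t -> measurable A ->
       (mu t z A = \int[lebesgue_rV d]_(x in A) (u z (val t) x)%:E)%E) &
    nonlinear_markov_core mu P.

(* The squared Euclidean norm; the library norm on ['rV[R]_d] is the maximum
   norm. *)
Definition sqnorm (x : Rd) : R := \sum_(i < d) x ord0 i ^+ 2.

Definition heat_kernel (z : Rd) (t : R) (x : Rd) : R :=
  (2 * pi * t) `^ (- (d%:R / 2)) * expR (- (sqnorm (x - z) / (2 * t))).

Definition std_normal (A : set Rd) : \bar R :=
  (\int[lebesgue_rV d]_(x in A)
     ((2 * pi) `^ (- (d%:R / 2)) * expR (- (sqnorm x / 2)))%:E)%E.

End nonlinear_markov.

(* Main.v *)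
Require Import Defs.
From HB Require Import structures.
From mathcomp Require Import all_boot all_order all_algebra.
From mathcomp Require Import all_classical all_reals all_analysis.
From mathcomp Require Import measurable_realfun giry.

(** The processes [z + sqrt t *: eta] involve no randomness besides the single
    Gaussian vector [eta], and at any time [s > 0] the position
    [y = z + sqrt s *: eta] reveals it: [eta = (sqrt s)^-1 *: (y - z)].  Given
    the parameter [(t, z)] of the current law, the present position therefore
    determines the whole past and future path, almost surely.  A process for
    which the present determines the past satisfies the Markov property for a
    trivial reason.  Let [G] be an event of the past, almost surely equal to
    [w s \in B].  Conditioning on [G] amounts to conditioning on the position at
    time [s], and the disintegration of the restarted law with respect to its
    initial position is exactly the conditional law given that position
    ([markov_of_present_determines_past]).

    Without its law, the position does not tell the path: the reconstruction
    uses [t] and [z].  This is why the Markov property is only a nonlinear one,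
    and why the laws of [z + sqrt t *: eta] must determine [(t, z)]; then every
    law in the family has exactly one continuation
    ([core_of_present_determines_past]).

    Four facts about the processes feed this criterion.  The present determines
    the past ([sqrt_process_past]): for [s > 0] this is the reconstruction
    above, and for [s = 0] the past is generated by the present.  The restarted
    laws disintegrate ([sqrt_process_disintegration]), with Dirac masses at the
    reconstructed paths for [t > 0].  The parameters are determined by the
    marginals ([sqrt_process_injective]): the distribution function of a
    coordinate of [eta] is strictly increasing, because the Gaussian density is
    positive, and this separates the centers, and then the variances.  Lastly,
    the marginals have the heat kernel as density ([sqrt_process_density]), by
    the affine change of variables in the product Lebesgue measure
    ([ge0_integral_affine_rV]), which is proved one coordinate at a time. *)

Set Implicit Arguments.
Unset Strict Implicit.
Unset Printing Implicit Defensive.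

Import Order.TTheory GRing.Theory Num.Theory.
Import numFieldNormedType.Exports.
Local Open Scope classical_set_scope.
Local Open Scope ring_scope.

(** * Affine substitution in the Lebesgue measure *)

Section affine_substitution.
Context {R : realType}.
Local Notation lambda := (@lebesgue_measure R).

Lemma measurable_affineR (a c : R) :
  measurable_fun [set: measurableTypeR R] (fun x : R => a + c * x).
Proof. by apply: measurable_funD => //; apply: measurable_funM. Qed.

(** Both sides are measures in [A] that agree on the half-open intervals, and
    the Lebesgue measure is determined by its values there. *)
Lemma lebesgue_measure_affine (a c : R) (A : set R) : 0 < c -> measurable A ->
  (c%:E * lambda ((fun x : R => a + c * x)%R @^-1` A) = lambda A)%E.
Proof.
move=> c0 mA; have c_ge0 : 0 <= c := ltW c0.
pose f x : measurableTypeR R := a + c * (x : measurableTypeR R).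
have mf : measurable_fun setT f := measurable_affineR a c.
pose m : {measure set (measurableTypeR R) -> \bar R} :=
  mscale (NngNum c_ge0) (pushforward lambda f).
apply/esym; rewrite (@lebesgue_measure_unique R (m mf))//.
move=> _ [[x y] /= xy <-]; rewrite /m /= /mscale /= /pushforward /=.
rewrite (_ : _ @^-1` _ = `](x - a) / c, (y - a) / c]%classic); last first.
  by apply/seteqP; split => u;
    rewrite /= /f !in_itv/= ltr_pdivrMr// ler_pdivlMr// (mulrC u) ltrBlDl
      lerBrDl.
rewrite !lebesgue_measure_itv/= !lte_fin ltr_pM2r ?invr_gt0// ltrD2r.
case: ifPn => _; last by rewrite mule0.
rewrite -!EFinD -EFinM -mulrBl mulrCA divff ?gt_eqF// mulr1.
by rewrite opprB addrA subrK.
Qed.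

Lemma ge0_integral_affine (a c : R) (f : R -> \bar R) : 0 < c ->
  measurable_fun setT f -> (forall x, (0 <= f x)%E) ->
  (c%:E * \int[lambda]_x f (a + c * x)%R = \int[lambda]_x f x)%E.
Proof.
move=> c0 mf f0; have c_ge0 : 0 <= c := ltW c0.
pose g x : measurableTypeR R := a + c * (x : measurableTypeR R).
have mg : measurable_fun setT g := measurable_affineR a c.
pose m : {measure set (measurableTypeR R) -> \bar R} :=
  mscale (NngNum c_ge0) (pushforward lambda g).
rewrite (_ : (\int[lambda]_x f x = \int[m mg]_x f x)%E); last first.
  apply: eq_measure_integral => //= A mA _.
  by rewrite -(lebesgue_measure_affine a c0 mA).
rewrite ge0_integral_mscale//; congr (_ * _)%E.
by rewrite ge0_integral_pushforward.
Qed.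

Lemma ge0_integral_lebesgue_rVS n (f : 'rV[R]_n.+1 -> \bar R) :
  measurable_fun setT f -> (forall x, (0 <= f x)%E) ->
  (\int[lebesgue_rV n.+1]_x f x =
   \int[lambda]_x \int[lebesgue_rV n]_v f (cons_rV (x, v)))%E.
Proof.
move=> mf f0 /=.
rewrite ge0_integral_pushforward//; last exact: measurable_cons_rV.
rewrite preimage_setT fubini_tonelli1//=.
apply: measurableT_comp => //; exact: measurable_cons_rV.
Qed.

Lemma measurable_integral_slice n (f : 'rV[R]_n.+1 -> \bar R) :
  measurable_fun setT f -> (forall x, (0 <= f x)%E) ->
  measurable_fun [set: measurableTypeR R]
    (fun x : R => \int[lebesgue_rV n]_v f (cons_rV (x, v)))%E.
Proof.
move=> mf f0; have mfc := measurableT_comp mf (@measurable_cons_rV R n).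
exact: (@measurable_fun_fubini_tonelli_F _ _ (measurableTypeR R) 'rV[R]_n R
  (lebesgue_rV n) (f \o @cons_rV R n) mfc (fun p => f0 (cons_rV p))).
Qed.

Lemma measurable_affine_rV n (z : 'rV[R]_n) (c : R) :
  measurable_fun setT (fun x : 'rV[R]_n => z + c *: x).
Proof.
apply: measurable_fun_mxP => i j.
rewrite [X in measurable_fun _ X](_ : _ =
    fun x : 'rV[R]_n => z i j + c * x i j).
  apply: measurable_funD => //; apply: measurable_funM => //.
  exact: measurable_coord.
by apply/funext => x; rewrite !mxE.
Qed.

(** Tonelli peels off the first coordinate, which contributes one factor [c] by
    the one-dimensional substitution; the other coordinates contribute
    [c ^+ n] by induction. *)
Lemma ge0_integral_affine_rV n (z : 'rV[R]_n) (c : R) (f : 'rV[R]_n -> \bar R) :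
  0 < c -> measurable_fun setT f -> (forall x, (0 <= f x)%E) ->
  ((c ^+ n)%:E * \int[lebesgue_rV n]_x f (z + c *: x)%R =
   \int[lebesgue_rV n]_x f x)%E.
Proof.
move=> c0; elim: n z f => [|n IH] z f mf f0.
  rewrite expr0 mul1e; apply: eq_integral => x _; congr f.
  by apply/rowP => -[].
have mfz := measurableT_comp mf (measurable_affine_rV z c).
rewrite [in LHS]ge0_integral_lebesgue_rVS// [in RHS]ge0_integral_lebesgue_rVS//.
have mfc := measurableT_comp mf (@measurable_cons_rV R n).
pose z' : 'rV[R]_n := rsubmx (z : 'rV_(1 + n)).
have zE x v : z + c *: cons_rV (x, v) =
    cons_rV (z ord0 ord0 + c * x, z' + c *: v).
  apply/rowP => i; rewrite !mxE; case: splitP => j ij; rewrite !mxE ?ord1.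
    by congr (z _ _ + _); apply: val_inj; rewrite /= ij ord1.
  by rewrite (_ : i = rshift 1 j)//; exact: val_inj.
pose G x := (\int[lebesgue_rV n]_v f (cons_rV (x, v)))%E.
have G0 x : (0 <= G x)%E by apply: integral_ge0.
have mG : measurable_fun setT G by exact: measurable_integral_slice.
rewrite -[RHS](ge0_integral_affine (z ord0 ord0) c0 mG G0).
rewrite exprS EFinM -muleA; congr (_ * _)%E.
rewrite -ge0_integralZl//; last 3 first.
- by apply: (measurable_integral_slice mfz) => x; exact: f0.
- by move=> x _; apply: integral_ge0.
- by rewrite lee_fin exprn_ge0// ltW.
apply: eq_integral => x _; under eq_integral do rewrite zE.
rewrite (IH z' (fun v => f (cons_rV (z ord0 ord0 + c * x, v))))//.
exact: (measurableT_comp mfc (pair1_measurable (z ord0 ord0 + c * x))).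
Qed.

End affine_substitution.

(** * Gaussian densities *)

Section gaussian.
Context {R : realType} {d : nat}.
Local Notation Rd := 'rV[R]_d.

Definition normal_density (x : Rd) : R :=
  (2 * pi) `^ (- (d%:R / 2)) * expR (- (sqnorm x / 2)).

Lemma normal_density_gt0 x : 0 < normal_density x.
Proof. by rewrite mulr_gt0 ?expR_gt0// powR_gt0// mulr_gt0 ?pi_gt0. Qed.

Lemma measurable_sqnorm : measurable_fun setT (@sqnorm R d).
Proof.
apply: measurable_sum => i; apply: measurable_funX; exact: measurable_coord.
Qed.

Lemma measurable_normal_density : measurable_fun setT normal_density.
Proof.
apply: measurable_funM => //; apply: measurableT_comp => //.
apply: measurableT_comp => //; apply: measurable_funM => //.
exact: measurable_sqnorm.
Qed.

Lemma measurable_heat_kernel (z : Rd) t : measurable_fun setT (heat_kernel z t).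
Proof.
apply: measurable_funM => //; apply: measurableT_comp => //.
apply: measurableT_comp => //; apply: measurable_funM => //.
apply: measurableT_comp; first exact: measurable_sqnorm.
under eq_fun do rewrite addrC -[X in _ + X]scale1r.
exact: measurable_affine_rV.
Qed.

Lemma heat_kernel_ge0 (z : Rd) t x : 0 <= heat_kernel z t x.
Proof. by rewrite mulr_ge0 ?expR_ge0// powR_ge0. Qed.

(** The Jacobian [sqrt t ^+ d] cancels the factor [t `^ (- (d / 2))] of the
    heat kernel. *)
Lemma heat_kernel_affine (z x : Rd) t : 0 < t ->
  Num.sqrt t ^+ d * heat_kernel z t (z + Num.sqrt t *: x) = normal_density x.
Proof.
move=> t0; rewrite /heat_kernel /normal_density mulrA; congr (_ * expR _).
  rewrite powRM ?mulr_ge0 ?pi_ge0 ?(ltW t0)// mulrCA -[RHS]mulr1; congr *%R.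
  rewrite -powR12_sqrt ?ltW// -powR_mulrn ?powR_ge0// -powRrM.
  by rewrite (mulrC 2^-1) powRN divff// gt_eqF// powR_gt0.
congr (- _); rewrite addrAC subrr add0r.
rewrite (_ : sqnorm _ = t * sqnorm x); last first.
  rewrite /sqnorm mulr_sumr; apply: eq_bigr => i _.
  by rewrite mxE exprMn sqr_sqrtr// ltW.
by rewrite (mulrC t) -mulf_div divff ?mulr1// gt_eqF.
Qed.

Lemma std_normal_affine (z : Rd) (t : R) (A : set Rd) : 0 < t -> measurable A ->
  std_normal ((fun x => z + Num.sqrt t *: x) @^-1` A) =
  (\int[lebesgue_rV d]_(x in A) (heat_kernel z t x)%:E)%E.
Proof.
move=> t0 mA; rewrite integral_mkcond.
have mh : measurable_fun setT ((fun x => (heat_kernel z t x)%:E) \_ A).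
  apply/(measurable_restrictT _ mA)/measurable_EFinP.
  apply: measurable_funTS; exact: measurable_heat_kernel.
have h0 x : (0 <= ((fun x => (heat_kernel z t x)%:E) \_ A) x)%E.
  by rewrite patchE; case: ifPn => // _; rewrite lee_fin heat_kernel_ge0.
have s0 : 0 < Num.sqrt t by rewrite sqrtr_gt0.
rewrite -(ge0_integral_affine_rV z s0 mh h0) -ge0_integralZl//; last first.
  exact: measurableT_comp mh (measurable_affine_rV z _).
rewrite /std_normal [LHS]integral_mkcond; apply: eq_integral => x _.
rewrite !patchE (_ : (x \in _) = (z + Num.sqrt t *: x \in A)); last first.
  by apply/idP/idP; rewrite !inE.
by case: ifPn => _; rewrite ?mule0// -EFinM heat_kernel_affine.
Qed.

Lemma measurable_slab (i : 'I_d) (J : interval R) :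
  measurable [set x : Rd | x ord0 i \in J].
Proof.
rewrite -[X in measurable X]setTI.
exact: (measurable_coord ord0 i measurableT (measurable_itv J)).
Qed.

(** The slab contains the cube with all coordinates in [ ]a, b] ], which has
    positive volume; a positive density has a positive integral over it. *)
Lemma std_normal_slab_gt0 (i : 'I_d) (a b : R) : a < b ->
  (0 < std_normal [set x : Rd | x ord0 i \in `]a, b]])%E.
Proof.
move=> ab; pose B := [set v : Rd | forall j, v ord0 j \in `]a, b]].
have mS := measurable_slab.
have mB : measurable B.
  rewrite (_ : B =
      \bigcap_(j in [set: 'I_d]) [set x : Rd | x ord0 j \in `]a, b]]).
    exact: fin_bigcap_measurable.
  by apply/seteqP; split => v /= h j; [move=> _; exact: h|exact: (h j I)].
have mphi D : measurable_fun D (fun x => (normal_density x)%:E).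
  apply/measurable_EFinP/measurable_funTS; exact: measurable_normal_density.
have phi0 x : (0 <= (normal_density x)%:E)%E.
  by rewrite lee_fin ltW// normal_density_gt0.
have BS : (std_normal B <= std_normal [set x : Rd | x ord0 i \in `]a, b]])%E.
  by apply: ge0_subset_integral => // [v _|v Bv]; [exact: phi0|exact: (Bv i)].
apply: lt_le_trans BS; rewrite lt_neqAle integral_ge0// ?andbT; last first.
  by move=> x _; exact: phi0.
apply/eqP => B0.
have /(ae_eq_integral_abs _ mB (mphi B))[N [mN N0 BN]] :
    (\int[lebesgue_rV d]_(x in B) `|(normal_density x)%:E| = 0)%E.
  by rewrite [RHS]B0; apply: eq_integral => x _; rewrite gee0_abs.
have : lebesgue_rV d B = 0%E.
  apply: (subset_measure0 mB mN _ N0) => x Bx; apply: BN => /= /(_ Bx)/eqP.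
  by rewrite eqe gt_eqF// normal_density_gt0.
rewrite (@lebesgue_rV_box R d (fun=> a) (fun=> b)); last first.
  by move=> _; exact: ltW.
move/eqP; rewrite eqe gt_eqF//; apply: prodr_gt0 => j _.
by rewrite subr_gt0.
Qed.

End gaussian.

(** * Events of the past determined by the present *)

Section almost_everywhere.
Context d (T : measurableType d) (R : realType) (m : {measure set T -> \bar R}).

Lemma ge0_integral_ae_eq_set (A B : set T) (f : T -> \bar R) :
  measurable A -> measurable B -> measurable_fun setT f ->
  (forall x, (0 <= f x)%E) -> {ae m, forall x, A x <-> B x} ->
  (\int[m]_(x in A) f x = \int[m]_(x in B) f x)%E.
Proof.
move=> mA mB mf f0 AB; rewrite [LHS]integral_mkcond [RHS]integral_mkcond.
have f0S S x : (0 <= (f \_ S) x)%E by rewrite patchE; case: ifPn.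
have mfS S : measurable S -> measurable_fun setT (f \_ S).
  by move=> mS; apply/(measurable_restrictT _ mS); exact: measurable_funTS.
apply: ge0_ae_eq_integral => //; [exact: mfS|exact: mfS|].
move: AB; apply: filterS => x ABx _; rewrite !patchE.
suff -> : (x \in A) = (x \in B) by [].
by apply/idP/idP; rewrite !inE => /ABx.
Qed.

Lemma measure_ae_eq_set (A B : set T) : measurable A -> measurable B ->
  {ae m, forall x, A x <-> B x} -> m A = m B.
Proof.
move=> mA mB /(@ge0_integral_ae_eq_set A B (cst 1%E) mA mB)-/(_ _ _).
by rewrite !integral_cst// !mul1e => ->.
Qed.

Lemma ae_of_full_measure (A : set T) : measurable A ->
  m setT = 1%E -> m A = 1%E -> {ae m, forall x, A x}.
Proof.
move=> mA mT mA1; exists (~` A); split => //; first exact: measurableC.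
have fT : (m setT < +oo)%E by rewrite mT ltry.
rewrite -setTD measureD// setTI -(subee (_ : 1%E \is a fin_num))//.
by congr (_ - _)%E.
Qed.

End almost_everywhere.

Section markov.
Context {R : realType} {d : nat}.
Local Notation Rd := 'rV[R]_d.
Local Notation C := (pathspace R d).

Lemma time_addr0 (s : Rplus R) : time_add s time0 = s.
Proof. by apply: val_inj; rewrite /= addr0. Qed.

Lemma time_addC (s t : Rplus R) : time_add s t = time_add t s.
Proof. by apply: val_inj; rewrite /= addrC. Qed.

Lemma time_addA (s t u : Rplus R) :
  time_add s (time_add t u) = time_add (time_add s t) u.
Proof. by apply: val_inj; rewrite /= addrA. Qed.

Lemma measurable_eval_preimage (t : Rplus R) (A : set Rd) :
  measurable A -> measurable (eval_at t @^-1` A : set C).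
Proof.
by move=> mA; rewrite -[X in measurable X]setTI; exact: measurable_eval_at.
Qed.

Lemma measurable_set1_rV (y : Rd) : measurable [set y].
Proof.
rewrite -(setCK [set y]); apply: measurableC; apply: open_measurable_mx.
apply: closed_openC; apply: accessible_closed_set1; apply: hausdorff_accessible.
exact: norm_hausdorff.
Qed.

Lemma path_filtration_measurable (s : Rplus R) (G : set C) :
  path_filtration s G -> measurable G.
Proof.
apply: smallest_sub; first exact: sigma_algebra_measurable.
move=> _ [r _ [B mB <-]]; rewrite setTI; exact: measurable_eval_preimage.
Qed.

Lemma path_filtration_eval (s : Rplus R) (B : set Rd) :
  measurable B -> path_filtration s (eval_at s @^-1` B).
Proof.
move=> mB; apply: sub_sigma_algebra; exists s => //=.
by exists B => //; rewrite setTI.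
Qed.

(** The measure [K y] is carried by the paths that start at [y], so restricting
    the initial position to [B] amounts to integrating over [B] only. *)
Lemma disintegration_start (P : probability C R) (xi : probability Rd R)
    (K : R.-pker Rd ~> C) (B : set Rd) (E : set C) :
  is_disintegration P xi K -> measurable B -> measurable E ->
  P (E `&` eval_at time0 @^-1` B) = (\int[xi]_(y in B) K y E)%E.
Proof.
move=> [PK K1] mB mE; have mB0 := @measurable_eval_preimage time0 B mB.
rewrite PK; last exact: measurableI.
rewrite [RHS]integral_mkcond; apply: ge0_ae_eq_integral => //.
- by apply: measurable_kernel; exact: measurableI.
- apply/(measurable_restrictT _ mB); apply: measurable_funTS.
  exact: measurable_kernel.
- by move=> y _; rewrite patchE; case: ifPn.
move: K1; apply: filterS => y Ky _; rewrite patchE.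
have {}Ky : {ae K y, forall w : C, w time0 = y}.
  apply: ae_of_full_measure => //; last exact: prob_kernel.
  exact: measurable_eval_preimage (measurable_set1_rV y).
case: ifPn => [|]; rewrite ?notin_setE ?inE => By.
  apply: measure_ae_eq_set => //; first exact: measurableI.
  move: Ky; apply: filterS => w wy; split => [[]//|Ew]; split => //.
  by rewrite /= /eval_at wy.
transitivity (K y set0); last exact: measure0.
apply: measure_ae_eq_set => //; first exact: measurableI.
by move: Ky; apply: filterS => w wy; split => // -[_]; rewrite /= /eval_at wy.
Qed.

(** The version of the conditional probability is the kernel itself, evaluated
    at the present position.  On an event [G] of the past, almost surely equal
    to [B (w s)], its integral is the integral over [B] of the disintegration
    of the restarted law [Ps], that is, the mass that [Ps] gives to the paths
    starting in [B] and lying in [A] at time [t]; shifting back by [s] turns it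
    into the mass of [G] and [w (t + s) \in A]. *)
Lemma markov_of_present_determines_past (P Ps : probability C R)
    (s t : Rplus R) (A : set Rd) (K : R.-pker Rd ~> C) :
  measurable A -> shifted P s ≡μ Ps -> is_disintegration Ps (marginal P s) K ->
  (forall G, path_filtration s G ->
     exists2 B, measurable B & {ae P, forall w, G w <-> B (eval_at s w)}) ->
  is_cond_prob P (path_filtration s) (eval_at (time_add t s) @^-1` A)
    (fun w => K (eval_at s w) (eval_at t @^-1` A)).
Proof.
move=> mA PsE hK past; set E := eval_at t @^-1` A.
have mE : measurable E by exact: measurable_eval_preimage.
have mK : measurable_fun setT (fun y => K y E) by exact: measurable_kernel.
have mf : measurable_fun setT (fun w => K (eval_at s w) E).
  exact: measurableT_comp mK (@measurable_eval_at _ _ s).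
split.
- move=> B mB; apply: (@path_filtration_eval s ((fun y => K y E) @^-1` B)).
  by rewrite -[X in measurable X]setTI; exact: mK.
- have i1 := finite_measure_integrable_cst P 1 measurableT.
  apply: (le_integrable _ _ _ i1) => //= w _.
  rewrite gee0_abs// normr1.
  apply: (@le_trans _ _ (K (eval_at s w) setT)); last by rewrite prob_kernel.
  by apply: le_measure; rewrite ?inE.
move=> G FG; have mG := path_filtration_measurable FG.
have [B mB GB] := past G FG; have mB0 := measurable_eval_preimage s mB.
have mEts : measurable (eval_at (time_add t s) @^-1` A : set C).
  exact: measurable_eval_preimage.
rewrite (ge0_integral_ae_eq_set mG mB0 mf)//.
(* Pass from paths to positions at time s, distributed as the marginal. *)
rewrite -[LHS](@ge0_integral_pushforward _ _ _ _ _ _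
  (@measurable_eval_at _ _ s) P B (fun y => K y E))//; last first.
  exact: measurable_funTS.
rewrite -[LHS](disintegration_start hK mB mE) -PsE; last first.
  by apply: measurableI => //; exact: measurable_eval_preimage.
apply: (@measure_ae_eq_set _ _ _ P).
- rewrite -[X in measurable X]setTI; apply: measurable_path_shift => //.
  by apply: measurableI => //; exact: measurable_eval_preimage.
- exact: measurableI.
move: GB; apply: filterS => w Gw /=.
change (A (w (time_add s t)) /\ B (w (time_add s time0)) <->
  A (w (time_add t s)) /\ G w).
by rewrite time_addr0 (time_addC s) Gw.
Qed.

End markov.

Section core.
Context {R : realType} {d : nat}.
Local Notation Rd := 'rV[R]_d.
Local Notation C := (pathspace R d).

Lemma path_shift_shift (s t : Rplus R) (w : C) :
  path_shift t (path_shift s w) = path_shift (time_add s t) w.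
Proof. by apply/continuousEP => u; exact: (congr1 w (time_addA s t u)). Qed.

Lemma shifted_shifted (P : probability C R) (s t : Rplus R) :
  shifted (shifted P s) t ≡μ shifted P (time_add s t).
Proof.
move=> A mA.
change (P [set w | A (path_shift t (path_shift s w))] =
  P [set w | A (path_shift (time_add s t) w)]).
by congr (P _); apply/seteqP; split => w /=; rewrite path_shift_shift.
Qed.

Lemma marginal_shifted (P : probability C R) (s t : Rplus R) :
  marginal (shifted P s) t ≡μ marginal P (time_add s t).
Proof. by []. Qed.

Lemma is_disintegration_eq (P : probability C R) (xi xi' : probability Rd R)
    (K : R.-pker Rd ~> C) :
  xi ≡μ xi' -> is_disintegration P xi K -> is_disintegration P xi' K.
Proof.
move=> xiE [PK [N [mN N0 KN]]]; split; last first.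
  by exists N; split => //; rewrite -xiE.
move=> B mB; rewrite PK//; apply: eq_measure_integral => A mA _.
exact: xiE.
Qed.

(** When the marginals determine their parameters [(t, z)], a law of the family
    has a single continuation, the law of the path of [P z] shifted by [t], and
    these continuations are consistent under further shifts.  The Markov
    property then follows from the hypothesis that events of the past are
    almost surely events of the present. *)
Lemma core_of_present_determines_past (P : Rd -> probability C R) :
  (forall z, marginal (P z) time0 ≡μ \d_z) ->
  (forall t z t' z', marginal (P z) t ≡μ marginal (P z') t' ->
     (t, z) = (t', z')) ->
  (forall t z, exists K,
     is_disintegration (shifted (P z) t) (marginal (P z) t) K) ->
  (forall t z s G, path_filtration s G -> exists2 B, measurable B &
     {ae shifted (P z) t, forall w, G w <-> B (eval_at s w)}) ->
  nonlinear_markov_core (fun t z => marginal (P z) t) P.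
Proof.
move=> start inj disint past; split => //.
pose P0 := [set zeta : probability Rd R |
  exists t z, zeta ≡μ marginal (P z) t].
have /choice[Q QP] : forall zeta : probability Rd R, exists q, P0 zeta ->
    exists t z, zeta ≡μ marginal (P z) t /\ q = shifted (P z) t.
  move=> zeta.
  have [[t [z ztz]]|nP0] := pselect (P0 zeta); last by exists (P 0).
  by exists (shifted (P z) t) => _; exists t, z.
have QE t z (zeta : probability Rd R) :
    zeta ≡μ marginal (P z) t -> Q zeta = shifted (P z) t.
  move=> ztz; have [|t' [z' [ztz' ->]]] := QP zeta; first by exists t, z.
  have [-> ->] // : (t', z') = (t, z).
  by apply: inj => A mA; rewrite -ztz'// ztz.
exists Q => [t z zeta ztz|]; first by rewrite (QE t z).
split => [zeta zeta' [t [z ztz]] zz'|zeta [t [z ztz]]].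
  have zt'z : zeta' ≡μ marginal (P z) t by move=> A mA; rewrite -zz'// ztz.
  by split; [exists t, z|rewrite (QE _ _ _ ztz) (QE _ _ _ zt'z)].
rewrite (QE _ _ _ ztz); split.
- move=> A mA; by rewrite marginal_shifted// ztz// time_addr0.
- by move=> s _; exists (time_add t s), z; exact: marginal_shifted.
- have [K KP] := disint t z; exists K; apply: is_disintegration_eq KP.
  by move=> A mA; rewrite ztz.
move=> s t' A K mA.
rewrite (QE (time_add t s) z); last exact: marginal_shifted.
move=> hK; eexists; last by apply: aeW => w; reflexivity.
apply: markov_of_present_determines_past hK _ => //.
- exact: shifted_shifted.
- exact: past.
Qed.

End core.

(** * The square-root process *)

Section sqrt_paths.
Context {R : realType} {d : nat}.
Local Notation Rd := 'rV[R]_d.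
Local Notation C := (pathspace R d).

(** The path [z + sqrt t *: x] that is at [y] at time [s]; at [s = 0] there is
    no such [x] in general, and the value is then the constant path [z]. *)
Definition path_through (z : Rd) (s : Rplus R) (y : Rd) : C :=
  sqrt_path z ((Num.sqrt (val s))^-1 *: (y - z)).

Lemma measurable_path_through z s : measurable_fun setT (path_through z s).
Proof.
apply: measurableT_comp (measurable_sqrt_path z) _.
under eq_fun do rewrite scalerBr addrC.
exact: measurable_affine_rV.
Qed.

Lemma path_through_sqrt_path z x s : 0 < val s ->
  path_through z s (sqrt_path z x s) = sqrt_path z x.
Proof.
move=> s0; rewrite /path_through /=; congr (sqrt_path z _).
by rewrite addrAC subrr add0r scalerA mulVf ?scale1r// gt_eqF// sqrtr_gt0.
Qed.

Lemma path_through_at z s y : 0 < val s -> path_through z s y s = y.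
Proof.
move=> s0.
change (z + Num.sqrt (val s) *: ((Num.sqrt (val s))^-1 *: (y - z)) = y).
by rewrite scalerA mulfV ?gt_eqF ?sqrtr_gt0// scale1r addrC subrK.
Qed.

Lemma path_filtration_time0 (G : set C) :
  path_filtration time0 G ->
  exists2 B, measurable B & G = eval_at time0 @^-1` B.
Proof.
have /sigma_algebra_preimage sa := @sigma_algebra_measurable _ Rd.
move=> /(smallest_sub (sa C setT (eval_at time0)))[].
  move=> _ [r /= r0 [B mB <-]]; exists B => //.
  suff -> : r = time0 by [].
  by apply: val_inj; apply/eqP; rewrite eq_le r0 time_ge0.
by move=> B mB <-; exists B; rewrite ?setTI.
Qed.

End sqrt_paths.

Section sqrt_process_law.
Context {R : realType} {d : nat} {dO : measure_display}
  {Omega : measurableType dO} (Pr : probability Omega R)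
  (eta : {mfun Omega >-> 'rV[R]_d}).
Local Notation Rd := 'rV[R]_d.
Local Notation C := (pathspace R d).
Local Notation V z := (distribution Pr (sqrt_process eta z)).

Lemma ae_shifted_sqrt_process (S : set C) z t : measurable S ->
  (forall omega, S (path_shift t (sqrt_path z (eta omega)))) ->
  {ae shifted (V z) t, forall w, S w}.
Proof.
move=> mS ST; exists (~` S); split => //; first exact: measurableC.
change (Pr [set omega | ~ S (path_shift t (sqrt_path z (eta omega)))] = 0%E).
rewrite (_ : [set _ | _] = set0) ?measure0//.
by apply/seteqP; split => omega //=; apply; exact: ST.
Qed.

(** For [s > 0] the path is almost surely the function [h] of its position at
    time [s], and the positions that [h] sends to [G] form the required [B].  At
    [s = 0] the position need not determine the path, but there the past
    consists of events of the present. *)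
Lemma sqrt_process_past t z s G : path_filtration s G ->
  exists2 B : set Rd, measurable B &
    {ae shifted (V z) t, forall w : C, G w <-> B (eval_at s w)}.
Proof.
move=> FG; have [s0|s0] := ltP 0 (val s); last first.
  have s0E : s = time0 by apply: val_inj; apply/eqP; rewrite eq_le s0 time_ge0.
  move: FG; rewrite s0E => /path_filtration_time0[B mB ->]; exists B => //.
  exact: aeW.
have mG := path_filtration_measurable FG.
have ts0 : 0 < val (time_add t s) by rewrite /= ltr_wpDl// time_ge0.
pose h := path_shift t \o path_through z (time_add t s).
have mh : measurable_fun setT h.
  exact: measurableT_comp (measurable_path_shift t)
    (measurable_path_through _ _).
have mB : measurable (h @^-1` G).
  by rewrite -[X in measurable X]setTI; exact: mh.
exists (h @^-1` G) => //.
have mB' := measurable_eval_preimage s mB.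
apply: ae_shifted_sqrt_process => [|omega].
  rewrite (_ : (fun w => _) = (G `&` eval_at s @^-1` (h @^-1` G)) `|`
      (~` G `&` ~` (eval_at s @^-1` (h @^-1` G)))).
    by apply: measurableU; apply: measurableI => //; exact: measurableC.
  apply/seteqP; split => w /=; last by case => -[].
  by have [Gw|Gw] := pselect (G w) => GB; [left|right]; tauto.
change (G (path_shift t (sqrt_path z (eta omega))) <->
  G (path_shift t (path_through z (time_add t s)
    (sqrt_path z (eta omega) (time_add t s))))).
by rewrite path_through_sqrt_path.
Qed.

(** For [t > 0] the path is a function of its position at time [t], and the
    kernel is the Dirac mass there.  For [t = 0] the initial position is almost
    surely [z], and a constant kernel disintegrates the law. *)
Lemma sqrt_process_disintegration t z :
  exists K, is_disintegration (shifted (V z) t) (marginal (V z) t) K.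
Proof.
have [t0|t0] := ltP 0 (val t); last first.
  pose mV : measurable_fun [set: Rd]
    (cst (shifted (V z) t : pprobability C R)) := measurable_cst _.
  exists (kprobability mV); split => [B mB|].
    by rewrite integral_cst//= probability_setT mule1.
  have t0E : val t = 0 by apply/eqP; rewrite eq_le t0 time_ge0.
  exists (~` [set z]); split.
  - by apply: measurableC; exact: measurable_set1_rV.
  - change (Pr [set omega | z + Num.sqrt (val t) *: eta omega <> z] = 0%E).
    rewrite t0E sqrtr0 (_ : [set _ | _] = set0) ?measure0//.
    by apply/seteqP; split => omega //=; rewrite scale0r addr0 => /(_ erefl).
  - move=> y /= + yz; apply; rewrite yz.
    change (Pr [set omega | z + Num.sqrt (val t + 0) *: eta omega = z] = 1%E).
    rewrite t0E addr0 sqrtr0 (_ : [set _ | _] = setT) ?probability_setT//.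
    by apply/seteqP; split => omega //=; rewrite scale0r addr0.
pose h := path_shift t \o path_through z t.
have mh : measurable_fun setT h.
  exact: measurableT_comp (measurable_path_shift t)
    (measurable_path_through _ _).
exists (kdirac mh); split => [B mB|]; last first.
  apply: aeW => y /=; rewrite /kdirac diracE mem_set//=.
  change (path_through z t y (time_add t time0) = y).
  by rewrite time_addr0 path_through_at.
have mhB : measurable (h @^-1` B).
  by rewrite -[X in measurable X]setTI; exact: mh.
transitivity (marginal (V z) t (h @^-1` B)); last first.
  rewrite -[LHS]mul1e -integral_cst// integral_mkcond; apply: eq_integral => y _.
  rewrite /kdirac/= diracE patchE (_ : (h y \in B) = (y \in h @^-1` B)).
    by case: ifPn.
  by apply/idP/idP; rewrite !inE.
change (Pr [set omega | B (path_shift t (sqrt_path z (eta omega)))] =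
  Pr [set omega |
    B (path_shift t (path_through z t (sqrt_path z (eta omega) t)))]).
by congr (Pr _); apply/seteqP; split => omega /=; rewrite path_through_sqrt_path.
Qed.

Lemma sqrt_process_start z : marginal (V z) time0 ≡μ \d_z.
Proof.
move=> A mA.
change (Pr [set omega | A (z + Num.sqrt 0 *: eta omega)] = \d_z A).
rewrite sqrtr0 diracE; under eq_set do rewrite scale0r addr0.
have [Az|Az] := pselect (A z).
  by rewrite mem_set// (_ : [set _ | _] = setT) ?probability_setT//;
    apply/seteqP; split.
by rewrite memNset// (_ : [set _ | _] = set0) ?measure0//;
  apply/seteqP; split.
Qed.

Hypothesis eta_normal : forall A : set Rd, measurable A ->
  distribution Pr eta A = std_normal A.

Lemma sqrt_process_density (t : Rplus R) z (A : set Rd) :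
  0 < val t -> measurable A ->
  marginal (V z) t A =
  (\int[lebesgue_rV d]_(x in A) (heat_kernel z (val t) x)%:E)%E.
Proof.
move=> t0 mA; rewrite -std_normal_affine// -eta_normal//.
by rewrite -[X in measurable X]setTI; exact: measurable_affine_rV.
Qed.

Definition coord_cdf (i : 'I_d) (c : R) :=
  Pr [set omega | eta omega ord0 i <= c].

Lemma measurable_eta_coord i :
  measurable_fun setT (fun omega => eta omega ord0 i).
Proof.
exact: measurableT_comp (measurable_coord ord0 i) (measurable_funPT eta).
Qed.

Lemma measurable_coord_le (i : 'I_d) (c : R) :
  measurable [set x : Rd | x ord0 i <= c].
Proof.
rewrite (_ : [set x | _] = [set x : Rd | x ord0 i \in `]-oo, c]]).
  exact: measurable_slab.
by apply/seteqP; split => x /=; rewrite in_itv.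
Qed.

Lemma measurable_eta_le i (c : R) :
  measurable [set omega | eta omega ord0 i <= c].
Proof.
rewrite -[X in measurable X]setTI.
exact: (measurable_funPT eta measurableT _ (measurable_coord_le i c)).
Qed.

Lemma measurable_affine_eta_le (z : Rd) (r : R) (i : 'I_d) (c : R) :
  measurable [set omega | z ord0 i + r * eta omega ord0 i <= c].
Proof.
rewrite (_ : [set omega | _] = setT `&`
    (fun omega => z ord0 i + r * eta omega ord0 i) @^-1` `]-oo, c]).
  have mf : measurable_fun setT (fun omega => z ord0 i + r * eta omega ord0 i).
    apply: measurable_funD => //; apply: measurable_funM => //.
    exact: measurable_eta_coord.
  by apply: mf => //; exact: measurable_itv.
by rewrite setTI; apply/seteqP; split => x /=; rewrite in_itv.
Qed.

Lemma coord_cdf_lt i (a b : R) : a < b -> (coord_cdf i a < coord_cdf i b)%E.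
Proof.
move=> ab; have me := @measurable_eta_coord i.
have mle := measurable_eta_le i.
have mab : measurable [set omega | eta omega ord0 i \in `]a, b]].
  by have := me measurableT _ (measurable_itv `]a, b]); rewrite setTI.
rewrite /coord_cdf (_ : [set omega | eta omega ord0 i <= b] =
    [set omega | eta omega ord0 i <= a] `|`
    [set omega | eta omega ord0 i \in `]a, b]]); last first.
  apply/seteqP; split => omega /=; rewrite in_itv /=.
    by move=> ->; rewrite andbT; case: leP; [left|right].
  by case=> [/le_trans->//|/andP[]//]; exact: ltW.
rewrite measureU//; last first.
  apply/seteqP; split => omega //= [] /[swap]; rewrite in_itv /= => /andP[+ _].
  by rewrite ltNge => /negP.
rewrite lteDl ?fin_num_measure//.
have := std_normal_slab_gt0 i ab; rewrite -eta_normal//.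
exact: measurable_slab.
Qed.

Lemma sqrt_process_coord_le z t i c :
  marginal (V z) t [set x : Rd | x ord0 i <= c] =
  Pr [set omega | z ord0 i + Num.sqrt (val t) * eta omega ord0 i <= c].
Proof.
change (Pr [set omega | (z + Num.sqrt (val t) *: eta omega) ord0 i <= c] =
  Pr [set omega | z ord0 i + Num.sqrt (val t) * eta omega ord0 i <= c]).
by congr (Pr _); apply/seteqP; split => omega /=; rewrite !mxE.
Qed.

(** If [z i < z' i], then at the threshold [z i] the first law has at least the
    mass [coord_cdf i 0], whatever [t] is.  The second one needs the coordinate
    of [eta] to lie below a negative number, which has strictly less mass. *)
Lemma marginal_eq_center_le t z t' z' i :
  marginal (V z) t ≡μ marginal (V z') t' -> z' ord0 i <= z ord0 i.
Proof.
move=> zz'; rewrite leNgt; apply/negP => zltz'.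
pose s := Num.sqrt (val t'); pose delta := z' ord0 i - z ord0 i.
have s1 : 0 < s + 1 by rewrite ltr_wpDl// sqrtr_ge0.
have delta0 : 0 < delta by rewrite subr_gt0.
(* With s + 1 in place of s the bound makes sense for t' = 0 as well. *)
have : (coord_cdf i (- (delta / (s + 1))) < coord_cdf i 0)%E.
  by apply: coord_cdf_lt; rewrite oppr_lt0 divr_gt0.
rewrite ltNge => /negP; apply.
apply: (@le_trans _ _ (marginal (V z) t [set x : Rd | x ord0 i <= z ord0 i])).
  rewrite sqrt_process_coord_le; apply: le_measure; rewrite ?inE //.
  - exact: measurable_eta_le.
  - exact: measurable_affine_eta_le.
  - by move=> omega /= h; rewrite gerDl mulr_ge0_le0// sqrtr_ge0.
rewrite zz'; last exact: measurable_coord_le.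
rewrite [leLHS]sqrt_process_coord_le; apply: le_measure; rewrite ?inE //.
- exact: measurable_affine_eta_le.
- exact: measurable_eta_le.
move=> omega /=; rewrite -/s -lerBrDl -opprB -/delta => h.
have e0 : eta omega ord0 i <= 0.
  rewrite leNgt; apply/negP => e0.
  have : 0 <= s * eta omega ord0 i by rewrite mulr_ge0 ?sqrtr_ge0// ltW.
  by rewrite leNgt (le_lt_trans h)// oppr_lt0.
by rewrite -mulNr ler_pdivlMr// mulrDr mulr1 mulrC (le_trans _ h)// gerDl.
Qed.

(** If [t < t'], then at the threshold [z i + sqrt t'] the second law has the
    mass [coord_cdf i 1], and the first one at least that of a larger
    half-line. *)
Lemma marginal_eq_time_le t t' z (i : 'I_d) :
  marginal (V z) t ≡μ marginal (V z) t' -> val t' <= val t.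
Proof.
move=> zz'; rewrite leNgt; apply/negP => tt'.
pose s := Num.sqrt (val t); pose s' := Num.sqrt (val t').
have t'0 : 0 < val t' by rewrite (le_lt_trans _ tt')// time_ge0.
have ss' : s < s' by rewrite ltr_sqrt.
have s0 : 0 <= s by rewrite sqrtr_ge0.
have s'0 : 0 < s' by rewrite sqrtr_gt0.
have sD0 : 0 < s + s' by rewrite ltr_wpDl.
(* b = 2 s' / (s + s') satisfies 1 < b and s * b <= s', even for s = 0. *)
have : (coord_cdf i 1 < coord_cdf i (2 * s' / (s + s')))%E.
  by apply: coord_cdf_lt; rewrite ltr_pdivlMr// mul1r mulr2n mulrDl mul1r ltrD2r.
rewrite ltNge => /negP; apply.
apply: (@le_trans _ _
  (marginal (V z) t [set x : Rd | x ord0 i <= z ord0 i + s'])).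
  rewrite sqrt_process_coord_le; apply: le_measure; rewrite ?inE //.
  - exact: measurable_eta_le.
  - exact: measurable_affine_eta_le.
  - move=> omega /= h; rewrite lerD2l -/s.
    rewrite (le_trans (ler_wpM2l s0 h))// mulrA ler_pdivrMr//.
    rewrite mulrA (mulrC s') ler_pM2r//.
    by rewrite mulrC mulr2n mulrDl mul1r lerD2l ltW.
rewrite zz'; last exact: measurable_coord_le.
rewrite [leLHS]sqrt_process_coord_le; apply: le_measure; rewrite ?inE //.
- exact: measurable_affine_eta_le.
- exact: measurable_eta_le.
by move=> omega /=; rewrite lerD2l -/s' -[X in _ <= X]mulr1 ler_pM2l.
Qed.

Lemma sqrt_process_injective t z t' z' : (0 < d)%N ->
  marginal (V z) t ≡μ marginal (V z') t' -> (t, z) = (t', z').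
Proof.
move=> d_gt0 zz'.
have z'z : marginal (V z') t' ≡μ marginal (V z) t by move=> A mA; rewrite zz'.
have zE : z' = z.
  apply/rowP => i; apply/eqP; rewrite eq_le.
  by rewrite (marginal_eq_center_le i zz') (marginal_eq_center_le i z'z).
move: zz' z'z; rewrite zE => tt' t't; congr pair; apply: val_inj; apply/eqP.
have i := Ordinal d_gt0; rewrite eq_le.
by rewrite (marginal_eq_time_le i tt') (marginal_eq_time_le i t't).
Qed.

End sqrt_process_law.

Theorem proposition5p2 (R : realType) (d : nat) (d_gt0 : (0 < d)%N)
  (dO : measure_display) (Omega : measurableType dO) (Pr : probability Omega R)
  (eta : {RV Pr >-> 'rV[R]_d})
  (eta_normal : forall A : set 'rV[R]_d, measurable A ->
     distribution Pr eta A = std_normal A) :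
  nonlinear_markov_core_density heat_kernel
    (fun z : 'rV[R]_d => distribution Pr (sqrt_process eta z)).
Proof.
exists (fun t z => marginal (distribution Pr (sqrt_process eta z)) t).
  split; first exact: sqrt_process_start.
  by move=> t z A t0 mA; exact: sqrt_process_density.
apply: core_of_present_determines_past.
- exact: sqrt_process_start.
- by move=> t z t' z'; exact: sqrt_process_injective.
- exact: sqrt_process_disintegration.
- exact: sqrt_process_past.
Qed.
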